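(* Let $G$ be a finite undirected graph without multiple edges, possibly with loops. Let $v_1, v_2, \dots, v_k$ be distinct vertices of $G$ such that there is a loop $l_i$ at $v_i$ for each $i = 1, \dots, k$, and let $G' = G - \{l_1, l_2, \dots, l_k\}$. Then $$\phi(G') = \phi(G) + \sum_{i=1}^{k} \phi\big(G - \{l_1, l_2, \dots, l_{i-1}\} - v_i\big).$$
   Context: Graphs are finite and undirected, have no multiple edges, and may have at most one loop at each vertex. For a graph $G$ with vertices $u_1,\dots,u_p$, the adjacency matrix $A(G) = [a_{ij}]$ is the $p \times p$ matrix with, for $i\neq j$, $a_{ij}=1$ if $u_i,u_j$ are adjacent and $0$ otherwise, and $a_{ii}=1$ if there is a loop at $u_i$ and $0$ otherwise. $\phi(G) = \phi(G;x) = \det(xI - A(G))$ is the characteristic polynomial of $A(G)$; for the graph with no vertices it equals $1$. Deleting a set of loops keeps all vertices; for $i=1$ the set $\{l_1,\dots,l_{i-1}\}$ is empty. Deleting a vertex $v$, written $-v$, removes $v$ and all edges and loops incident to it. $G$ may have further loops at vertices other than $v_1,\dots,v_k$, which then remain in $G'$. *)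

(* Defs.v *)
From mathcomp Require Import all_boot all_order all_algebra.

Set Implicit Arguments.
Unset Strict Implicit.
Unset Printing Implicit Defensive.

Import GRing.Theory.
Local Open Scope ring_scope.

(* Symmetric but not necessarily irreflexive: [adj G x x] means that there is
   a loop at [x]. *)
Record lgraph (V : finType) := LGraph {
  adj :> rel V;
  adj_sym : symmetric adj
}.

Definition has_loop (V : finType) (G : lgraph V) (x : V) : bool := adj G x x.

Section Deletion.
Variables (V : finType) (G : lgraph V).

(* A loop is identified with the vertex carrying it. *)
Definition del_loops_rel (L : {set V}) : rel V :=
  fun x y => adj G x y && ~~ ((x == y) && (x \in L)).

Lemma del_loops_sym (L : {set V}) : symmetric (del_loops_rel L).
Proof.
move=> x y; rewrite /del_loops_rel adj_sym eq_sym.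
by case: eqP => // ->.
Qed.

Definition del_loops (L : {set V}) : lgraph V := LGraph (del_loops_sym L).

Definition del_vertex_rel (v : V) : rel {x : V | x != v} :=
  fun x y => adj G (val x) (val y).

Lemma del_vertex_sym (v : V) : symmetric (@del_vertex_rel v).
Proof. by move=> x y; rewrite /del_vertex_rel adj_sym. Qed.

Definition del_vertex (v : V) : lgraph {x : V | x != v} :=
  LGraph (@del_vertex_sym v).

(* The vertices are numbered by [enum_val]; the characteristic polynomial does
   not depend on this choice. *)
Definition adj_mx : 'M[int]_#|V| :=
  \matrix_(i < #|V|, j < #|V|) (adj G (enum_val i) (enum_val j))%:R.

Definition phi : {poly int} := char_poly adj_mx.

End Deletion.

(* Main.v *)
(* Removing the loop at a vertex [w] adds [1] to the [(w, w)] entry of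
   [xI - A], so by linearity of the determinant in row [w] it adds to the
   characteristic polynomial the principal minor obtained by deleting [w].
   Removing the loops one at a time and telescoping gives the formula. *)
Require Import Defs.
From mathcomp Require Import all_boot all_order all_algebra.
From mathcomp Require Import perm.

Import GRing.Theory.

Local Open Scope ring_scope.

(** An injection between ordinals of equal size is a permutation; it acts on both rows and columns,
    so its sign occurs twice and cancels. *)
Lemma det_mxsub_inj (R : comNzRingType) (m n : nat) (f : 'I_m -> 'I_n)
    (A : 'M[R]_n) :
  m = n -> injective f -> \det (mxsub f f A) = \det A.
Proof.
move=> emn; subst m => f_inj; pose s := perm f_inj.
have -> : mxsub f f A = row_perm s (col_perm s A).
  by apply/matrixP=> i j; rewrite !mxE !permE.
rewrite row_permE col_permE !det_mulmx !det_perm odd_permV mulrCA.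
by rewrite -signr_addb addbb mulr1.
Qed.

Lemma char_poly_mxsub_inj (R : comNzRingType) (m n : nat) (f : 'I_m -> 'I_n)
    (A : 'M[R]_n) :
  m = n -> injective f -> char_poly (mxsub f f A) = char_poly A.
Proof.
move=> emn f_inj; rewrite /char_poly.
rewrite -(det_mxsub_inj _ _ _ _ (char_poly_mx A) emn f_inj).
by congr (\det _); apply/matrixP=> i j; rewrite !mxE (inj_eq f_inj).
Qed.

Lemma char_poly_sub_delta (R : comNzRingType) (n : nat) (A : 'M[R]_n)
    (i0 : 'I_n) :
  char_poly (A - delta_mx i0 i0) =
  char_poly A + char_poly (row' i0 (col' i0 A)).
Proof.
(* [C] is [xI - A] with row [i0] replaced by the unit vector at [i0]; expanding along that row
   leaves only the principal minor. *)
pose C := \matrix_(i, j)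
  if i == i0 then (j == i0)%:R else char_poly_mx A i j.
have -> : char_poly (row' i0 (col' i0 A)) = \det C.
  rewrite (expand_det_row C i0) (bigD1 i0) //=.
  rewrite big1 => [|j /negPf ne_j]; last by rewrite mxE eqxx ne_j mul0r.
  rewrite mxE !eqxx mul1r addr0 /cofactor addnn -signr_odd odd_double mul1r.
  congr (\det _); apply/matrixP=> i j.
  rewrite !mxE [lift i0 i == i0]eq_sym (negPf (neq_lift _ _)).
  by rewrite (inj_eq lift_inj).
(* The coefficients 1 exhibit row [i0] as a linear combination of the rows of [xI - A] and [C]. *)
rewrite -[char_poly A]mul1r -[\det C]mul1r.
apply: (determinant_multilinear (i0 := i0)).
- apply/rowP=> j; rewrite !mxE !eqxx /= !mul1r polyCB opprB.
  by rewrite addrA addrAC -!addrA; case: (j == i0); rewrite ?polyC1 ?polyC0.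
- apply/matrixP=> i j; rewrite !mxE [lift i0 i == i0]eq_sym.
  by rewrite (negPf (neq_lift _ _)) subr0.
- apply/matrixP=> i j; rewrite !mxE [lift i0 i == i0]eq_sym.
  by rewrite (negPf (neq_lift _ _)) subr0.
Qed.

Lemma eq_phi (V : finType) (G H : lgraph V) : adj G =2 adj H -> phi G = phi H.
Proof.
by move=> eqGH; congr char_poly; apply/matrixP=> i j; rewrite !mxE eqGH.
Qed.

(** Both matrices are indexed by the vertices other than [w], but one numbering comes from the
    subtype and the other skips [enum_rank w] in the numbering of [V]. The map [f] below translates
    between them. *)
Lemma phi_del_vertex (V : finType) (G : lgraph V) (w : V) :
  phi (del_vertex G w) =
  char_poly (row' (enum_rank w) (col' (enum_rank w) (adj_mx G))).
Proof.
set i0 := enum_rank w.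
have ne_w (j : 'I_#|V|.-1) : enum_val (lift i0 j) != w.
  by apply: contraNneq (neq_lift i0 j) => jw; rewrite -(enum_valK (lift i0 j)) jw.
pose f j := enum_rank (Sub (enum_val (lift i0 j)) (ne_w j) : {x : V | x != w}).
have f_inj : injective f.
  by move=> i j /enum_rank_inj/(congr1 val)/enum_val_inj/lift_inj.
have card_f : #|V|.-1 = #|{: {x : V | x != w}}|.
  by rewrite card_sub -(cardC1 w).
rewrite /phi.
rewrite -(char_poly_mxsub_inj _ _ _ _ (adj_mx (del_vertex G w)) card_f f_inj).
congr char_poly; apply/matrixP=> i j.
by rewrite !mxE !enum_rankK.
Qed.

Lemma phi_del_loop (V : finType) (G : lgraph V) (L : {set V}) (w : V) :
  has_loop G w -> w \notin L ->
  phi (del_loops G (w |: L)) =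
  phi (del_loops G L) + phi (del_vertex (del_loops G L) w).
Proof.
move=> Gw wL; rewrite phi_del_vertex -char_poly_sub_delta.
congr char_poly; apply/matrixP=> i j; rewrite !mxE /= /del_loops_rel in_setU1.
rewrite !(can2_eq enum_valK enum_rankK).
(* Only the diagonal entry at [w] changes: it drops from 1 to 0, its loop being still present since
   [w] is not in [L]. *)
rewrite enum_valK; have [<-|ne_ij] := eqVneq i j; last first.
  by have [<-|_] := eqVneq i; rewrite ?(eq_sym j) ?(negPf ne_ij) subr0.
rewrite andbb; have [->|_] := eqVneq i; last by rewrite subr0.
by rewrite enum_rankK (negPf wL) andbF andbT [adj G w w]Gw subrr.
Qed.

Theorem theorem3p7 (V : finType) (G : lgraph V) (k : nat) (v : 'I_k -> V)
    (v_inj : injective v) (v_loop : forall i : 'I_k, has_loop G (v i)) :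
  phi (del_loops G [set v i | i : 'I_k]) =
  phi G + \sum_(i < k)
    phi (del_vertex (del_loops G [set v j | j : 'I_k & (j < i)%N]) (v i)).
Proof.
pose L m := [set v j | j : 'I_k & (j < m)%N].
pose F m := phi (del_loops G (L m)).
have F0 : F 0 = phi G.
  (* [L 0] is empty, so the adjacency relations agree pointwise. *)
  apply: eq_phi => x y /=; rewrite /del_loops_rel.
  suff -> : x \in L 0 = false by rewrite andbF andbT.
  by apply/imsetP=> -[j]; rewrite inE.
have Fk : F k = phi (del_loops G [set v i | i : 'I_k]).
  rewrite /F; congr (phi (del_loops G _)); apply/setP=> x.
  by apply/imsetP/imsetP=> -[i _ ->]; exists i; rewrite ?inE.
have FS (i : 'I_k) : F i.+1 - F i = phi (del_vertex (del_loops G (L i)) (v i)).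
  have LS : L i.+1 = v i |: L i.
    apply/setP=> x; rewrite in_setU1; apply/imsetP/predU1P.
      case=> j; rewrite inE ltnS leq_eqVlt => /predU1P[/val_inj-> -> | ltji ->].
        by left.
      by right; apply: imset_f; rewrite inE.
    case=> [->|/imsetP[j]]; first by exists i; rewrite // inE.
    by rewrite inE => ltji ->; exists j; rewrite // inE ltnS ltnW.
  rewrite /F LS phi_del_loop //; first by rewrite addrC addKr.
  (* As [v] is injective, the loop at [v i] is not among those already removed. *)
  by rewrite mem_imset // inE ltnn.
rewrite -Fk -F0 -(eq_bigr _ (fun i _ => FS i)).
rewrite -(big_mkord xpredT (fun i => F i.+1 - F i)).
by rewrite telescope_sumr // addrC subrK.
Qed.
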